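(* Let $F=F(a_1,\dots,a_k)$, $k\ge 2$, and let $\phi\in Aut(F)$ be a hyperbolic automorphism with parameters $s>1$ and $m\ge 1$ (an integer), that is, such that for every $w\in F$ $$s\|w\|\le\max\{\|\phi^m(w)\|,\|\phi^{-m}(w)\|\}.$$ Then $$\liminf_{n\to\infty}\sqrt[n]{\lambda(\phi^n)}\ge s^{1/m}>1.$$
   Context: Let $A=\{a_1,\dots,a_k\}$ be the fixed free basis of $F$. For $w\in F$, $|w|$ is the freely reduced length of $w$ over $A^{\pm1}$, and $\|w\|$ is the cyclically reduced length of $w$, i.e. the length of any cyclically reduced word over $A^{\pm1}$ conjugate to $w$. The boundary $\partial F$ is the set of semi-infinite freely reduced words over $A^{\pm1}$; $\omega_n\in F$ is the initial segment of length $n$ of $\omega\in\partial F$; $\mu_A$ is the Borel probability measure on $\partial F$ giving the set of all $\omega$ beginning with a freely reduced word $v\ne 1$ the mass $\frac{1}{2k(2k-1)^{|v|-1}}$. For an automorphism $\psi$ of $F$, the generic stretching factor $\lambda(\psi)=\lambda_A(\psi)$ is the constant such that $\lim_{n\to\infty}\frac{|\psi(\omega_n)|}{n}=\lambda(\psi)$ for $\mu_A$-a.e. $\omega\in\partial F$ (this constant exists). *)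

(* Defs.v *)
From HB Require Import structures.
From mathcomp Require Import all_boot all_order all_algebra.
From mathcomp Require Import all_classical all_reals all_analysis.
Set Implicit Arguments.
Unset Strict Implicit.
Unset Printing Implicit Defensive.
Import Order.TTheory GRing.Theory Num.Theory.
Import numFieldNormedType.Exports.

(* The letter (i, false) is the basis element a_i, and (i, true) is a_i^-1. *)
Notation letter k := ('I_k * bool)%type.

Section FreeGroup.
Variable k : nat.
Implicit Types (x y : letter k) (s t : seq (letter k)).

Definition inv_letter x : letter k := (x.1, ~~ x.2).

Definition no_cancel : rel (letter k) := fun x y => y != inv_letter x.

Definition reduced s : bool := sorted no_cancel s.

Record free_group := FreeGroup { word : seq (letter k); _ : reduced word }.

HB.instance Definition _ := [isSub for word].
HB.instance Definition _ := [Choice of free_group by <:].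

Lemma wordP (w : free_group) : reduced (word w).
Proof. by case: w. Qed.

Lemma inv_letterK : involutive inv_letter.
Proof. by case=> i b; rewrite /inv_letter /= negbK. Qed.

Lemma inv_letter_neq x : inv_letter x != x.
Proof. by case: x => i b; rewrite /inv_letter xpair_eqE /= eqxx; case: b. Qed.

Lemma no_cancelC x y : no_cancel x y = no_cancel (inv_letter y) (inv_letter x).
Proof.
by rewrite /no_cancel inv_letterK eq_sym (inv_eq inv_letterK).
Qed.

Definition push x s :=
  if s is y :: s' then if y == inv_letter x then s' else x :: s else [:: x].

Definition reduce s := foldr push [::] s.

Lemma reduced_behead x s : reduced (x :: s) -> reduced s.
Proof. by case: s => //= y s /andP[]. Qed.

Lemma reduced_push x s : reduced s -> reduced (push x s).
Proof.
case: s => //= y s hs; case: eqP => [_|/eqP nxy]; last by rewrite /= {1}/no_cancel nxy.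
exact: reduced_behead hs.
Qed.

Lemma reduced_foldr_push s t : reduced t -> reduced (foldr push t s).
Proof. by move=> ht; elim: s => //= x s /(@reduced_push x). Qed.

Lemma pushK x s : reduced s -> push (inv_letter x) (push x s) = s.
Proof.
case: s => [|y s] /=; first by rewrite inv_letterK eqxx.
case: eqP => [-> |_] hs /=; last by rewrite inv_letterK eqxx.
case: s hs => //= z s /andP[hz _].
by move: hz; rewrite /no_cancel => /negbTE ->.
Qed.

Lemma push_reduced x s : reduced (x :: s) -> push x s = x :: s.
Proof. by case: s => //= y s /andP[/negbTE -> _]. Qed.

Lemma reduce_id s : reduced s -> reduce s = s.
Proof.
elim: s => //= x s IH hs; rewrite /reduce /= -/(reduce s) IH ?push_reduced //.
exact: reduced_behead hs.
Qed.

Lemma foldr_push_push x s t : reduced t ->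
  foldr push t (push x s) = push x (foldr push t s).
Proof.
move=> ht; case: s => //= y s; case: eqP => //= ->.
by have := pushK (inv_letter x) (reduced_foldr_push s ht); rewrite inv_letterK.
Qed.

Lemma foldr_pushA s t u : reduced u ->
  foldr push u (foldr push t s) = foldr push (foldr push u t) s.
Proof. by move=> hu; elim: s => //= x s IH; rewrite foldr_push_push // IH. Qed.

Definition inv_word s := rev (map inv_letter s).

Lemma reduced_inv s : reduced s -> reduced (inv_word s).
Proof.
rewrite /reduced /inv_word rev_sorted sorted_map; apply: sub_sorted => x y /=.
by rewrite /relpre/= -no_cancelC.
Qed.

Lemma foldr_push_inv s t : reduced t ->
  foldr push (foldr push t s) (inv_word s) = t.
Proof.
move=> ht; elim: s => //= x s IH.
by rewrite /inv_word /= rev_cons -cats1 foldr_cat /= pushK ?reduced_foldr_push.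
Qed.

Definition free_one : free_group := @FreeGroup [::] isT.
Definition free_mul (u v : free_group) : free_group :=
  FreeGroup (reduced_foldr_push (word u) (wordP v)).
Definition free_inv (u : free_group) : free_group :=
  FreeGroup (reduced_inv (wordP u)).

Lemma free_mulE u v : word (free_mul u v) = reduce (word u ++ word v).
Proof.
by rewrite /reduce foldr_cat -/(reduce (word v)) reduce_id ?wordP.
Qed.

Lemma free_mulA : associative free_mul.
Proof.
by move=> u v w; apply: val_inj; rewrite /= foldr_pushA // wordP.
Qed.

Lemma free_mul1g : left_id free_one free_mul.
Proof. by move=> u; apply: val_inj. Qed.

Lemma free_mulg1 : right_id free_one free_mul.
Proof. by move=> u; apply: val_inj; rewrite /= -/(reduce _) reduce_id ?wordP. Qed.

Lemma free_mulVg : left_inverse free_one free_inv free_mul.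
Proof.
move=> u; apply: val_inj => /=.
rewrite -{1}(reduce_id (wordP u)); exact: foldr_push_inv.
Qed.

Lemma free_mulgV : right_inverse free_one free_inv free_mul.
Proof.
move=> u; rewrite -{1}[u]free_mul1g -(free_mulVg (free_inv u)).
by rewrite -!free_mulA [free_mul (free_inv u) _]free_mulA free_mulVg free_mul1g.
Qed.

HB.instance Definition _ := isGroup.Build free_group
  free_mulA free_mul1g free_mulg1 free_mulVg free_mulgV.

Implicit Types u v w g : free_group.

Definition len w : nat := size (word w).

Lemma size_push x s : (size (push x s) <= (size s).+1)%N.
Proof. by case: s => //= y s; case: ifP => //= _; rewrite ltnW. Qed.

Lemma len_mul u v : (len (u * v)%g <= len u + len v)%N.
Proof.
rewrite /len /=; elim: (word u) => //= x s IH.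
exact: leq_trans (size_push _ _) _.
Qed.

Lemma len_inv u : len (u^-1)%g = len u.
Proof. by rewrite /len /= /inv_word size_rev size_map. Qed.

Definition cyclically_reduced w : bool := cycle no_cancel (word w).

(* The choice operator [get] picks the common length of the cyclically reduced
   conjugates of w; it is pinned down by [cyc_lenE] and [cyc_reduced_conj]. *)
Definition cyc_len w : nat :=
  get [set n | exists g, cyclically_reduced (w ^ g)%g /\ len (w ^ g)%g = n]%classic.

Lemma mul_cat u v : reduced (word u ++ word v) ->
  word (u * v)%g = word u ++ word v.
Proof. by move=> h; rewrite -[LHS]/(word (free_mul u v)) free_mulE reduce_id. Qed.

Lemma cyc_reduced_expg v n : cyclically_reduced v ->
  word (v ^+ n)%g = flatten (nseq n (word v)).
Proof.
rewrite /cyclically_reduced => cv; elim: n => // n IH.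
rewrite expgS mul_cat IH // => {IH}.
have hv := wordP v; case: (word v) cv hv => [|x s] cv hv.
  by elim: n.
case: n => [|n]; first by rewrite cats0.
elim: n => [|n IHn]; move: cv hv; rewrite /reduced /= rcons_path => /andP[cs cl] hs.
  by rewrite cats0 cat_path hs /= cl.
by rewrite cat_path hs /= cl.
Qed.

Lemma cyc_reduced_len_le u v g : cyclically_reduced u -> cyclically_reduced v ->
  u = (v ^ g)%g -> (len u <= len v)%N.
Proof.
move=> cu cv uvg; pose n := (2 * len g).+1.
have sz w : cyclically_reduced w -> len (w ^+ n)%g = (n * len w)%N.
  move=> cw; rewrite /len cyc_reduced_expg // size_flatten /shape map_nseq.
  by rewrite sumn_nseq mulnC.
have : (len (u ^+ n)%g <= n * len v + 2 * len g)%N.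
  rewrite uvg -conjXg conjgE; apply: leq_trans (len_mul _ _) _.
  rewrite len_inv; apply: leq_trans (leq_add (leqnn _) (len_mul _ _)) _.
  by rewrite sz // addnC -addnA addnn mul2n.
rewrite sz // => h; rewrite leqNgt; apply/negP => lt.
have := leq_mul (leqnn n) lt; rewrite mulnS => h'.
by have := leq_trans h' h; rewrite addnC leq_add2l /n ltnn.
Qed.

Lemma cyc_reduced_conj w : exists g, cyclically_reduced (w ^ g)%g.
Proof.
have [n] := ubnP (len w); elim: n w => // n IH w.
have [cw _|] := boolP (cyclically_reduced w); first by exists 1%g; rewrite conjg1.
rewrite /cyclically_reduced /len ltnS => ncw hn.
have hw := wordP w.
case ew : (word w) hn ncw hw => [|x s] //= hn.
case/lastP: s ew hn => [|s y] ew hn.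
  by rewrite /= /no_cancel eq_sym inv_letter_neq.
move=> ncw hw; have {ncw} yx : y = inv_letter x.
  move: ncw; rewrite (rcons_path no_cancel x (rcons s y)) last_rcons.
  rewrite (_ : path _ _ _ = true) //= /no_cancel negbK => /eqP ->.
  by rewrite inv_letterK.
have rs : reduced s.
  move: hw; rewrite /reduced /= rcons_path => /andP[hw _].
  by case: s hw {ew hn} => //= z s /andP[].
pose a : free_group := @FreeGroup [:: x] isT; pose v := FreeGroup rs.
have wE : w = (v ^ a^-1)%g.
  have rxs : reduced (x :: s).
    by move: hw; rewrite /reduced /= rcons_path => /andP[].
  have avE : word (a * v)%g = x :: s by rewrite /= push_reduced.
  rewrite conjgE invgK mulgA; apply: val_inj.
  have rv : reduced (word (a * v)%g ++ word a^-1%g).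
    by rewrite avE; move: hw; rewrite yx -cats1.
  rewrite -[RHS]/(word (a * v * a^-1)%g) mul_cat // avE -[LHS]/(word w) ew yx.
  by rewrite cats1.
have [|g hg] := IH v.
  by apply: leq_trans hn; rewrite /len /= size_rcons.
suff : exists h, cyclically_reduced (w ^ h)%g by [].
by exists (a * g)%g; rewrite wE conjgM conjgKV.
Qed.

Lemma cyc_lenE v g : cyclically_reduced v -> cyc_len (v ^ g)%g = len v.
Proof.
move=> cv; rewrite /cyc_len.
set P := (X in get X).
have [h [ch <-]] : P (get P).
  by apply: getPex; exists (len v); exists g^-1%g; rewrite conjgK.
apply/eqP; rewrite eqn_leq (@cyc_reduced_len_le _ v (g * h)%g) ?conjgM //=.
by apply: (@cyc_reduced_len_le _ _ (g * h)^-1%g) => //; rewrite -[(_ ^ h)%g]conjgM conjgK.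
Qed.

End FreeGroup.

Section Boundary.
Variable k : nat.

Record boundary := Boundary {
  ray :> nat -> letter k;
  ray_no_cancel : forall n, no_cancel (ray n) (ray n.+1) }.

HB.instance Definition _ := gen_eqMixin boundary.
HB.instance Definition _ := gen_choiceMixin boundary.

(* The topology induced by the product of the discrete topologies. *)
HB.instance Definition _ := Topological.copy boundary
  (initial_topology (ray : boundary -> {ptws nat -> discrete_topology (letter k)})).

Lemma reduced_mkseq (w : boundary) n : reduced (mkseq w n).
Proof.
apply/(sortedP (w 0%N)) => i; rewrite size_mkseq => hi.
by rewrite !nth_mkseq ?ray_no_cancel // ltnW.
Qed.

Definition initial_segment (w : boundary) n : free_group k :=
  FreeGroup (reduced_mkseq w n).

End Boundary.

(* A measurable type must be inhabited, and the boundary is empty in rank 0,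
   hence the rank k.+1 from here on. *)
Section GenericStretching.
Variable k : nat.

Definition const_ray : boundary k.+1 :=
  @Boundary k.+1 (fun=> (ord0, false)) (fun=> isT).

HB.instance Definition _ := isPointed.Build (boundary k.+1) const_ray.

Definition borel_boundary :=
  g_sigma_algebraType (@open (boundary k.+1)).

Variable R : realType.
Local Open Scope ring_scope.

Definition cylinder (v : free_group k.+1) : set borel_boundary :=
  [set w | initial_segment w (len v) = v]%classic.

Lemma coordinate_continuous i :
  continuous (fun w : boundary k.+1 => w i : discrete_topology (letter k.+1)).
Proof.
move=> w; apply: (continuous_comp (g := proj i)
  (f := ray (k := k.+1) :
     boundary k.+1 -> {ptws nat -> discrete_topology (letter k.+1)})).
  exact: initial_continuous.
exact: proj_continuous.
Qed.

Lemma open_cylinder v : @open (boundary k.+1) (cylinder v).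
Proof.
rewrite openE => /= w; move: (w : boundary k.+1) => {}w wv; rewrite /interior /=.
have : \forall u \near w, forall i : 'I_(len v),
      (u : boundary k.+1) i = w i.
  have := @filter_forall (boundary k.+1) 'I_(len v)
    (fun i u => u i = w i) (nbhs w) (nbhs_filter w).
  apply => i.
  exact: (@coordinate_continuous i w [set w i]%classic).
apply: filterS => u uw; rewrite /cylinder /= -wv; apply: val_inj => /=.
have -> : len (initial_segment w (len v)) = len v by rewrite wv.
apply: (@eq_from_nth _ (w 0%N)); rewrite !size_mkseq // => i hi.
rewrite !nth_mkseq //; exact: (uw (Ordinal hi)).
Qed.

Lemma measurable_cylinder v : measurable (cylinder v).
Proof. by apply: sub_sigma_algebra; exact: open_cylinder. Qed.

Definition is_uniform_measure (mu : probability borel_boundary R) : Prop :=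
  forall v : free_group k.+1, v <> 1%g ->
    mu (cylinder v) =
      (((2 * k.+1)%:R * (2 * k.+1 - 1)%:R ^+ (len v - 1)%N)^-1)%:E.

Definition is_generic_stretching_factor (mu : probability borel_boundary R)
    (psi : free_group k.+1 -> free_group k.+1) (l : R) : Prop :=
  {ae mu, forall w : borel_boundary,
    (fun n => (len (psi (initial_segment w n)))%:R / n%:R : R) @ \oo --> l}%classic.

End GenericStretching.

(* [phi_inv] stands for the inverse of [phi], so that [iter m phi_inv] is
   phi^(-m). *)
Definition hyperbolic_with (k : nat) (R : realType)
    (phi phi_inv : free_group k -> free_group k) (s : R) (m : nat) : Prop :=
  [/\ 1 < s, (1 <= m)%N &
     forall w : free_group k,
       s * (cyc_len w)%:R <=
         Num.max (cyc_len (iter m phi w))%:R (cyc_len (iter m phi_inv w))%:R]%R.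

(* Main.v *)
Require Import Defs.
From HB Require Import structures.
From mathcomp Require Import all_boot all_order all_algebra.
From mathcomp Require Import all_classical all_reals all_analysis.
From mathcomp Require Import zify lra.
Set Implicit Arguments.
Unset Strict Implicit.
Unset Printing Implicit Defensive.
Import Order.TTheory GRing.Theory Num.Theory.
Import numFieldNormedType.Exports.

(* The hypothesis says that the sequence a_i = ||phi^(m i) w|| satisfies
   s a_i <= max (a_(i-1), a_(i+1)), so as soon as a_0 < s a_1 it grows
   geometrically forever: a_(i+1) >= s a_i for all i >= 1. Only a_0 < s a_1 needs
   genericity, and it follows by counting. An automorphism psi permutes conjugacy
   classes, and two cyclically reduced conjugate words are rotations of each
   other; hence at most (n+1) (l+1) r(l) cyclically reduced words v of length n
   have ||psi v|| <= l, where r(l) is the number of reduced words of length l.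
   For n = (p+1) j and l = p j this is negligible with respect to the number of
   cyclically reduced words of length n, which are themselves a positive
   proportion of all reduced words. So the w whose prefix v of length n is
   cyclically reduced with ||phi^m v|| > l, for infinitely many n, have positive
   measure, and one of them satisfies |phi^n (w_i)| / i --> lambda (phi^n). *)

(** * Conjugation of cyclically reduced words *)

Section FreeGroupWords.
Variable k : nat.
Implicit Types (x y : letter k) (s t : seq (letter k)) (u v g : free_group k).

Definition gen x : free_group k := @FreeGroup k [:: x] isT.

Lemma cycle_reduced s : cycle (@no_cancel k) s -> reduced s.
Proof. by case: s => // x s; rewrite /reduced /= rcons_path => /andP[]. Qed.

Lemma reduced_suffix s t : reduced (s ++ t) -> reduced t.
Proof. by elim: s => //= x s IH /reduced_behead. Qed.

Lemma reduced_cat s x y t : reduced (rcons s x) -> reduced (y :: t) ->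
  no_cancel x y -> reduced (rcons s x ++ y :: t).
Proof.
case: s => [|z s] /= hs ht xy; first by rewrite xy.
by rewrite cat_path last_rcons hs /= xy.
Qed.

Lemma conj_gen_head v x t : cyclically_reduced v -> word v = x :: t ->
  word (v ^ gen x)%g = rot 1 (word v).
Proof.
rewrite /cyclically_reduced => cv ev.
have hxt : reduced (x :: t) by rewrite -ev wordP.
have ht := reduced_behead hxt.
have hv : v = (gen x * FreeGroup ht)%g.
  by apply: val_inj; rewrite -[RHS]/(word _) mul_cat //= ev.
have htx : reduced (t ++ [:: x]).
  by move: cv; rewrite ev -(rot_cycle 1) rot1_cons cats1 => /cycle_reduced.
by rewrite {1}hv conjgE !mulgA mulVg mul1g mul_cat // ev rot1_cons cats1.
Qed.

Lemma conj_gen_last v x t : cyclically_reduced v ->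
  word v = rcons t (inv_letter x) ->
  word (v ^ gen x)%g = rotr 1 (word v).
Proof.
rewrite /cyclically_reduced => cv ev.
have ht : reduced t.
  have := wordP v; rewrite ev; case: (t) => //= y t'.
  by rewrite rcons_path => /andP[].
have hv : v = (FreeGroup ht * (gen x)^-1)%g.
  apply: val_inj; rewrite -[RHS]/(word _) mul_cat /= /inv_word /= cats1 //.
  by rewrite -ev wordP.
have htx : reduced ([:: inv_letter x] ++ t).
  by move: cv; rewrite ev -(rotr_cycle 1) rotr1_rcons => /cycle_reduced.
by rewrite {1}hv conjgE mulgVK mul_cat // ev rotr1_rcons.
Qed.

Lemma rot_closed s t i : t = rot i s -> forall j, exists l, rot j t = rot l s.
Proof.
move=> -> j.
have [hj|hj] := leqP j (size s); last first.
  by exists i; rewrite rot_oversize // size_rot ltnW.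
have [hi|hi] := leqP i (size s); last first.
  by exists j; rewrite (rot_oversize (ltnW hi)).
by rewrite rot_add_mod //; eexists.
Qed.

(** Induction on [len g]: if the first letter [x] of [g] is the first letter of [v], or its inverse
    is the last one, conjugation by [gen x] rotates [v] and leaves a shorter conjugator. Otherwise
    [v ^ g] is not cyclically reduced. *)
Lemma cyc_reduced_conj_rot v g : cyclically_reduced v ->
  cyclically_reduced (v ^ g)%g -> exists i, word (v ^ g)%g = rot i (word v).
Proof.
have [n] := ubnP (len g); elim: n v g => // n IH v g hn cv cvg.
case eg : (word g) => [|x s].
  by exists 0; rewrite rot0 (_ : g = 1%g) ?conjg1 //; apply: val_inj.
have hs : reduced s by have := wordP g; rewrite eg => /reduced_behead.
have hg : g = (gen x * FreeGroup hs)%g.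
  by apply: val_inj; rewrite -[RHS]/(word _) mul_cat ?eg //; have := wordP g; rewrite eg.
have step : (exists i, word (v ^ gen x)%g = rot i (word v)) ->
    exists i, word (v ^ g)%g = rot i (word v).
  case=> i hi.
  have [| | |j] := IH (v ^ gen x)%g (FreeGroup hs).
  - by move: hn; rewrite /len eg.
  - by rewrite /cyclically_reduced hi rot_cycle.
  - by rewrite -conjgM -hg.
  - by rewrite -conjgM -hg => ->; apply: rot_closed hi j.
case ev : (word v) => [|y t].
  by exists 0; rewrite (_ : v = 1%g) ?conj1g //; apply: val_inj.
have [yx|yx] := eqVneq y x.
  by rewrite -ev; apply: step; exists 1; apply: (@conj_gen_head _ _ t); rewrite // ev yx.
have evy := ev; case: (lastP (y :: t)) ev => [|t' z] ev.
  by rewrite evy in ev.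
have [zx|zx] := eqVneq z (inv_letter x).
  rewrite -ev; apply: step; exists (size (word v) - 1).
  by apply: (@conj_gen_last _ _ t'); rewrite // ev zx.
have rvg : reduced (word v ++ word g).
  rewrite ev eg; apply: reduced_cat; rewrite -?eg -?ev ?wordP //.
  by rewrite /no_cancel -(inj_eq (can_inj (@inv_letterK k))) inv_letterK eq_sym.
(* Nothing cancels in [g^-1 v g], which is thus not cyclically reduced. *)
have rgvg : reduced (word g^-1%g ++ word (v * g)%g).
  rewrite mul_cat //= eg /inv_word /= rev_cons.
  have -> : rev (map (@inv_letter k) s) = inv_word s by [].
  move: (rvg); case ev' : (word v) => [|y' t''] rvg'.
    by move: ev; rewrite ev'; case: (t').
  move: ev'; rewrite evy => -[<- <-].
  apply: reduced_cat; last by rewrite /no_cancel inv_letterK.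
    by have := reduced_inv (wordP g); rewrite /inv_word eg /= rev_cons.
  by rewrite -cat_cons -evy -eg.
move: cvg; rewrite /cyclically_reduced conjgE mul_cat //.
(* Rotating [g^-1 v g] past [g^-1] exhibits the factor [g g^-1], which would be reduced and hence
   the word of [1], although [g] is nonempty. *)
rewrite -(rot_cycle (size (word g^-1%g))) rot_size_cat mul_cat // => /cycle_reduced.
rewrite -catA => /reduced_suffix rgg.
have : word (g * g^-1)%g = word g ++ word g^-1%g by apply: mul_cat.
by rewrite mulgV eg.
Qed.

End FreeGroupWords.

(** * Counting cyclically reduced words and contracted words *)

Section WordCounting.
Variable k : nat.
Local Notation L := (letter k.+1).
Implicit Types (x y : L) (s t : seq L) (u v w g : free_group k.+1).

(* The trivial element when [s] is not reduced. *)
Definition of_word s : free_group k.+1 := insubd (1%g : free_group k.+1) s.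

Lemma word_of_word s : reduced s -> word (of_word s) = s.
Proof. exact: insubdK. Qed.

Definition reduced_words n := [set t : n.-tuple L | reduced t].

Definition cyclic_words n := [set t : n.-tuple L | cycle (@no_cancel _) t].

Lemma cyclic_words_sub n : cyclic_words n \subset reduced_words n.
Proof. by apply/fintype.subsetP => t; rewrite !inE; apply: cycle_reduced. Qed.

(** At most two letters are excluded, and a basis of at least two elements gives at least four. *)
Lemma exists_letter_between x y : (0 < k)%N ->
  exists z, no_cancel x z && no_cancel z y.
Proof.
move=> k0; pose A := [set inv_letter x; inv_letter y].
have : (#|A| < #|{: L}|)%N.
  rewrite cards2 card_prod card_ord card_bool.
  by case: (_ != _); case: (k) k0.
rewrite -cardsT => hA.
have : ~~ ([set: L] \subset A) by apply: contraL hA => /subset_leq_card; rewrite -leqNgt.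
case/subsetPn => z _; rewrite !inE negb_or => /andP[zx zy].
by exists z; rewrite /no_cancel zx -(inj_eq (can_inj (@inv_letterK _))) inv_letterK eq_sym.
Qed.

(** A letter that fits between the two ends closes a reduced word up cyclically, and deleting it
    recovers the word. *)
Lemma card_cyclic_words n : (0 < k)%N -> (0 < n)%N ->
  (#|reduced_words n| <= #|cyclic_words n.+1|)%N.
Proof.
move=> k0; case: n => // n _.
pose f (t : n.+1.-tuple L) : n.+2.-tuple L :=
  [tuple of rcons t (odflt (thead t)
    [pick z | no_cancel (last (thead t) t) z && no_cancel z (thead t)])].
have f_inj : injective f.
  move=> t t' /(congr1 val) /= /eqP; rewrite eqseq_rcons => /andP[/eqP h _].
  exact: val_inj.
rewrite -(card_imset _ f_inj); apply/subset_leq_card/fintype.subsetP => _ /imsetP[t ht ->].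
move: ht; rewrite !inE /f /=; case: pickP => [z /andP[h1 h2]|h].
  case/tupleP: t h1 h2 => x t; rewrite /reduced /= !theadE => h1 h2 ht.
  by rewrite !rcons_path last_rcons h2 ht h1.
by have [z hz] := exists_letter_between (last (thead t) t) (thead t) k0; rewrite h in hz.
Qed.

Definition cyc_reduced_rep w := (w ^ sval (cid (cyc_reduced_conj w)))%g.

Lemma cyc_reduced_repP w : cyclically_reduced (cyc_reduced_rep w).
Proof. by rewrite /cyc_reduced_rep; case: cid. Qed.

Lemma len_cyc_reduced_rep w : len (cyc_reduced_rep w) = cyc_len w.
Proof.
rewrite -(cyc_lenE (sval (cid (cyc_reduced_conj w)))^-1%g (cyc_reduced_repP w)).
by rewrite conjgK.
Qed.

Lemma cyc_len_le w : (cyc_len w <= len w)%N.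
Proof.
have cw := cyc_reduced_repP w; rewrite -len_cyc_reduced_rep.
pose g := sval (cid (cyc_reduced_conj w)); pose n := (2 * len g).+1.
(* Compare the lengths of the n-th powers, as conjugation by [g] costs only a
   constant. *)
have lenX v p : (len (v ^+ p)%g <= p * len v)%N.
  elim: p => [|p IH]; first by rewrite expg0.
  by rewrite expgS mulSn (leq_trans (len_mul _ _)) // leq_add2l.
have : (len (cyc_reduced_rep w ^+ n)%g <= n * len w + 2 * len g)%N.
  rewrite -conjXg conjgE -/g; apply: leq_trans (len_mul _ _) _.
  rewrite len_inv; apply: leq_trans (leq_add (leqnn _) (len_mul _ _)) _.
  by rewrite addnCA addnn mul2n leq_add2r.
have -> : len (cyc_reduced_rep w ^+ n)%g = (n * len (cyc_reduced_rep w))%N.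
  rewrite /len cyc_reduced_expg // size_flatten /shape map_nseq.
  by rewrite sumn_nseq mulnC.
move=> h; rewrite leqNgt; apply/negP => /(leq_mul (leqnn n)) h'.
by have := leq_trans h' h; rewrite mulnS addnC leq_add2l /n ltnn.
Qed.

Lemma cyc_len_reduced w : cyclically_reduced w -> cyc_len w = len w.
Proof. by move=> cw; rewrite -[w in LHS]conjg1 cyc_lenE. Qed.

(** Repeating the last letter never cancels; an empty [s] is padded with [x]. *)
Lemma reduced_pad s x l : reduced s -> (size s <= l)%N ->
  exists2 t : l.-tuple L, reduced t & take (size s) t = s.
Proof.
move=> rs sl; pose p := nseq (l - size s) (last x s).
have hp : size (s ++ p) == l by rewrite size_cat size_nseq subnKC.
exists (Tuple hp) => /=; last by rewrite take_size_cat.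
have rp y n : path (@no_cancel _) y (nseq n y).
  by elim: n => //= n ->; rewrite /no_cancel eq_sym inv_letter_neq.
rewrite /p; case: (s) rs => [_|y s'] /=.
  by case: (l - _)%N => //= n; apply: rp.
by rewrite /reduced /= cat_path => ->; apply: rp.
Qed.

Definition contracted_words (psi : free_group k.+1 -> free_group k.+1) n l :=
  [set t in cyclic_words n | (cyc_len (psi (of_word t)) <= l)%N].

Lemma card_contracted_words psi n l : {morph psi : u g / (u ^ g)%g} ->
  bijective psi ->
  (#|contracted_words psi n l| <= n.+1 * l.+1 * #|reduced_words l|)%N.
Proof.
move=> psiJ psi_bij; have [psi' psiK psi'K] := psi_bij.
pose x0 : L := (ord0, false).
pose c (t : n.-tuple L) := word (cyc_reduced_rep (psi (of_word t))).
(* [v0 s] is one contracted word whose image has representative [s]; all the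
   others are rotations of it, so [F] is onto. A representative of length at
   most [l] is coded as a prefix of a reduced word of length exactly [l]. *)
pose v0 s := odflt (nseq_tuple n x0) [pick t in contracted_words psi n l | c t == s].
pose F (a : 'I_n.+1 * 'I_l.+1 * l.-tuple L) :=
  [tuple of rot a.1.1 (v0 (take a.1.2 a.2))].
have hF : contracted_words psi n l \subset
    F @: finset.setX [set: 'I_n.+1 * 'I_l.+1] (reduced_words l).
  apply/fintype.subsetP => t ht.
  have rc : reduced (c t) by apply: wordP.
  have sc : (size (c t) <= l)%N.
    by move: ht; rewrite inE => /andP[_]; rewrite -len_cyc_reduced_rep.
  have [p rp tp] := reduced_pad x0 rc sc.
  have [t' ht' [ct' vt']] : exists2 t', t' \in contracted_words psi n l &
      c t' = c t /\ v0 (c t) = t'.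
    rewrite /v0; case: pickP => [t' /andP[ht' /eqP ct']|/(_ t)]; first by exists t'.
    by rewrite ht eqxx.
  have cyc z : z \in contracted_words psi n l ->
      cyclically_reduced (of_word z) /\ word (of_word z) = z.
    rewrite !inE => /andP[hz _]; rewrite /cyclically_reduced word_of_word //.
    exact: cycle_reduced.
  have [ct et] := cyc _ ht; have [ct1 et'] := cyc _ ht'.
  have [g hg] : exists g, of_word t = (of_word t' ^ g)%g.
    move/val_inj: ct'; rewrite /cyc_reduced_rep.
    case: cid => g /= _; case: cid => h /= _ e.
    (* Equal representatives make the images conjugate by [g * h^-1]; [psi'] pulls this conjugator
       back, as [psi] respects conjugation. *)
    exists (psi' (g * h^-1)%g).
    by apply: (can_inj psiK); rewrite psiJ psi'K conjgM e conjgK.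
  have [|i hi] := cyc_reduced_conj_rot (g := g) ct1; first by rewrite -hg.
  (* Rotations by more than [n] are trivial, so the index can be cut down to [n]. *)
  have hin : (minn i n < n.+1)%N by rewrite ltnS geq_minr.
  apply/imsetP; exists (Ordinal hin, Ordinal (sc : (_ < l.+1)%N), p).
    by rewrite !inE.
  apply: val_inj => /=; rewrite tp vt' -{2}(size_tuple t') -rot_minn.
  by rewrite -et -et' hg.
apply: leq_trans (subset_leq_card hF) _; apply: leq_trans (leq_imset_card _ _) _.
by rewrite cardsX cardsT card_prod !card_ord.
Qed.

End WordCounting.

(** * Polynomial against exponential growth *)

Lemma cube_le_expn M j : (2 < M)%N -> (2 < j)%N -> (j ^ 3 <= M ^ j)%N.
Proof.
move=> M3; elim: j => // j IH; rewrite ltnS leq_eqVlt => /orP[/eqP <-|j3].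
  by rewrite leq_exp2r.
rewrite (expnS M); apply: leq_trans (leq_mul M3 (IH j3)).
rewrite !expnS expn0; nia.
Qed.

(** For [n = (p+1) j] and [l = p j], this makes the growth [M ^ j] from length [l] to length [n]
    beat the factor [(n+1) (l+1)] of [card_contracted_words]. The extra [M] pays for the letter
    added in [card_cyclic_words], and the [2] keeps half of the words. *)
Lemma quadratic_le_expn M p : (2 < M)%N -> exists J, forall j, (J <= j)%N ->
  (2 * ((p.+1 * j).+1 * (p * j).+1) * M <= M ^ j)%N.
Proof.
(* Both linear factors are at most [(p + 2) * j], so the left side is at most
   [2 * M * (p + 2) ^ 2 * j ^ 2], hence at most [j ^ 3]. *)
move=> M3; exists (3 + 2 * M * (p + 2) ^ 2)%N => j hj.
have j3 : (2 < j)%N by apply: leq_trans hj; rewrite leq_addr.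
apply: leq_trans (cube_le_expn M3 j3).
have hj' : (2 * M * (p + 2) ^ 2 <= j)%N by apply: leq_trans hj; rewrite leq_addl.
apply: (@leq_trans (2 * M * (p + 2) ^ 2 * j ^ 2)).
  rewrite -(mulnA (2 * M)) -expnMn -mulnn mulnAC leq_mul2l.
  by rewrite leq_mul ?orbT //; nia.
by rewrite (expnS j 2) leq_mul2r hj' orbT.
Qed.

(** * Masses of sets of prefixes *)

Section UniformMeasure.
Variables (R : realType) (k : nat).
Local Notation L := (letter k.+1).
Variable mu : probability (borel_boundary k) R.
Hypothesis hmu : is_uniform_measure mu.

Definition prefix_tuple (w : boundary k.+1) n : n.-tuple L :=
  Tuple (introT eqP (size_mkseq w n)).

Definition prefix_in n (V : {set n.-tuple L}) : set (borel_boundary k) :=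
  [set w | prefix_tuple w n \in V]%classic.

Definition cylinder_mass n : R := ((2 * k.+1 * (2 * k.+1 - 1) ^ n.-1)%:R)^-1%R.

Lemma prefix_reduced w n : prefix_tuple w n \in reduced_words k n.
Proof. by rewrite inE; apply: reduced_mkseq. Qed.

Lemma of_word_prefix w n : of_word (prefix_tuple w n) = initial_segment w n.
Proof. by apply: val_inj => /=; rewrite -[LHS]/(word _) word_of_word //; apply: reduced_mkseq. Qed.

Lemma prefix_in1 n (t : n.-tuple L) : t \in reduced_words k n ->
  prefix_in [set t] = cylinder (of_word t).
Proof.
rewrite inE => rt; apply/seteqP.
have hl : len (of_word t) = n by rewrite /len word_of_word // size_tuple.
split=> w; rewrite /prefix_in /cylinder /= finset.in_set1 hl -of_word_prefix.
  by move/eqP->.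
move=> /(congr1 (@word _)); rewrite !word_of_word //; last exact: reduced_mkseq.
by move=> h; apply/eqP/val_inj.
Qed.

(** Cylinders are split off one at a time from a finite disjoint union; [0 < n] because
    [is_uniform_measure] speaks of nontrivial words only. *)
Lemma prefix_in_mass n (V : {set n.-tuple L}) : (0 < n)%N ->
  V \subset reduced_words k n ->
  measurable (prefix_in V) /\ mu (prefix_in V) = (#|V|%:R * cylinder_mass n)%:E%R.
Proof.
move=> n0; have [N] := ubnP #|V|; elim: N V => // N IH V hN hV.
have [->|[t tV]] := finset.set_0Vmem V.
  have -> : prefix_in (finset.set0 : {set n.-tuple L}) = classical_sets.set0.
    by apply/seteqP; split=> w //; rewrite /prefix_in /= finset.in_set0.
  by rewrite measure0 cards0 mul0r; split => //; apply: measurable0.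
have tR := fintype.subsetP hV _ tV.
have rt : reduced t by move: tR; rewrite inE.
have hVt : prefix_in V = (cylinder (of_word t) `|` prefix_in (V :\ t))%classic.
  rewrite -prefix_in1 //; apply/seteqP; split=> w; rewrite /prefix_in /= !inE.
    by move=> ->; rewrite andbT; case: eqVneq; [left|right].
  by case=> [/eqP->|/andP[]].
have dis : (cylinder (of_word t) `&` prefix_in (V :\ t) = classical_sets.set0)%classic.
  rewrite -prefix_in1 //; apply/seteqP; split=> w //; rewrite /prefix_in /= !inE.
  by case=> /eqP->; rewrite eqxx.
have [] := IH (V :\ t).
- by move: hN; rewrite (cardsD1 t) tV.
- exact: fintype.subset_trans (finset.subD1set _ _) hV.
move=> mV mass; have mt := measurable_cylinder (of_word t).
rewrite hVt; split; first exact: measurableU.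
transitivity (mu (cylinder (of_word t)) + mu (prefix_in (V :\ t)))%E.
  exact: measureU.
rewrite mass (cardsD1 t V) tV hmu; last first.
  move=> /(congr1 (@word _)); rewrite word_of_word // => h.
  by move: (size_tuple t) n0; rewrite h => <-.
rewrite -EFinD natrD mulrDl mul1r /len word_of_word // size_tuple /cylinder_mass.
by rewrite -natrX -natrM !subn1.
Qed.

(* Obtained by adding up the masses of all cylinders of length n. *)
Lemma card_reduced_words n : (0 < n)%N ->
  #|reduced_words k n| = (2 * k.+1 * (2 * k.+1 - 1) ^ n.-1)%N.
Proof.
move=> n0; have [_] := prefix_in_mass n0 (fintype.subxx _).
have -> : prefix_in (reduced_words k n) = classical_sets.setT.
  by apply/seteqP; split=> w // _; apply: prefix_reduced.
rewrite probability_setT => -[] /esym; rewrite /cylinder_mass => /divr1_eq /eqP.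
by rewrite eqr_nat => /eqP.
Qed.

End UniformMeasure.

(** By continuity from above along the tail unions, the limsup has mass at least [c], so it does not
    fit into a null set containing the failures of [Q]. *)
Lemma lim_sup_set_ae d (T : measurableType d) (R : realType)
    (P : probability T R) (F : (set T)^nat) (c : R) (Q : set T) :
  (forall n, measurable (F n)) -> (0 < c)%R ->
  (\forall n \near \oo, (c%:E <= P (F n))%E)%classic ->
  {ae P, forall x, Q x} -> exists2 x, Q x & lim_sup_set F x.
Proof.
move=> mF c0 cF [N [mN PN QN]].
have mU n : measurable (\bigcup_(j >= n) F j)%classic.
  by apply: bigcup_measurable => j _.
have mS : measurable (lim_sup_set F) by apply: bigcap_measurable => // n _.
have cS : (c%:E <= P (lim_sup_set F))%E.
  have cvgU := lim_sup_set_cvg P F mF.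
  apply: (cvge_ge _ (cvgU _)).
    near=> n; apply: (@le_trans _ _ (P (F n))); first by near: n.
    by apply: le_measure; rewrite ?inE //; apply: bigcup_sup => /=.
  by apply: le_lt_trans (probability_le1 P (mU 0%N)) _; rewrite ltry.
apply/not_exists2P => hQ.
have : (P (lim_sup_set F) <= P N)%E.
  apply: le_measure; rewrite ?inE // => x Sx; apply: QN => /= Qx.
  by case: (hQ x).
rewrite PN => /(le_trans cS); rewrite lee_fin => /(lt_le_trans c0).
by rewrite ltxx.
Unshelve. all: by end_near. Qed.

(** * Good prefixes occur infinitely often *)

Section GoodWords.
Variables (R : realType) (k : nat).
Variable mu : probability (borel_boundary k) R.
Hypothesis hmu : is_uniform_measure mu.
Hypothesis k0 : (0 < k)%N.
Variable psi : free_group k.+1 -> free_group k.+1.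
Hypothesis psiJ : {morph psi : u g / (u ^ g)%g}.
Hypothesis psi_bij : bijective psi.

Definition good_words n l := cyclic_words k n :\: contracted_words psi n l.

Lemma card_good_words p : (0 < p)%N -> exists J, forall j, (J <= j)%N ->
  (#|reduced_words k (p.+1 * j).-1| <= 2 * #|good_words (p.+1 * j) (p * j)|)%N.
Proof.
move=> p0; pose M := (2 * k.+1 - 1)%N.
have [|J hJ] := @quadratic_le_expn M p; first by rewrite /M; lia.
exists (J + 1)%N => j hj; have {hJ} := hJ j (leq_trans (leq_addr _ _) hj).
have j0 : (0 < j)%N by apply: leq_trans hj; rewrite addn1.
have pj0 : (0 < p * j)%N by rewrite muln_gt0 p0.
set n := (p.+1 * j)%N; set l := (p * j)%N => hM.
have nE : n = (j + l)%N by rewrite /n /l mulSn.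
have l0 : (0 < l)%N by [].
have n1 : (0 < n.-1)%N by rewrite nE; lia.
have nS : n = n.-1.+1 by rewrite prednK // nE; lia.
have bad := card_contracted_words n l psiJ psi_bij.
have cyc := card_cyclic_words k0 n1; rewrite -nS in cyc.
(* Contracted words number at most half of the reduced words of length [n - 1], which cyclically
   reduced words of length [n] at least match. *)
have hbad : (2 * #|contracted_words psi n l| <= #|reduced_words k n.-1|)%N.
  apply: leq_trans (leq_mul (leqnn 2) bad) _.
  rewrite !(card_reduced_words hmu) // -/M.
  have -> : (n.-1).-1 = (j.-1 + l.-1)%N by rewrite nE; lia.
  have M0 : (0 < M)%N by rewrite /M; lia.
  have hB : (2 * (n.+1 * l.+1) <= M ^ j.-1)%N.
    by rewrite -(leq_pmul2r M0) -expnSr prednK.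
  by have := leq_mul hB (leqnn (2 * k.+1 * M ^ l.-1)); rewrite expnD; lia.
have hsub : contracted_words psi n l \subset cyclic_words k n.
  by apply/fintype.subsetP => t; rewrite inE => /andP[].
by rewrite /good_words cardsD (finset.setIidPr hsub); lia.
Qed.

Lemma good_words_mass p : (0 < p)%N -> exists2 c : R, (0 < c)%R &
  (\forall j \near \oo,
     (c%:E <= mu (prefix_in (good_words (p.+1 * j) (p * j))))%E)%classic.
Proof.
move=> p0; have [J hJ] := card_good_words p0; pose M := (2 * k.+1 - 1)%N.
have M0 : (0 < M)%N by rewrite /M; lia.
(* The [2] comes from [card_good_words]; [M] is the ratio of the numbers of reduced words of lengths
   [n] and [n - 1]. *)
exists ((2 * M)%:R^-1)%R; first by rewrite invr_gt0 ltr0n muln_gt0.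
exists (J + 2)%N => // j /= hj; have {hJ} := hJ j (leq_trans (leq_addr _ _) hj).
set n := (p.+1 * j)%N; set l := (p * j)%N => hc.
have j2 : (1 < j)%N by apply: leq_trans hj; rewrite leq_addl.
have n2 : (1 < n)%N by rewrite /n; nia.
have [||_ ->] := prefix_in_mass hmu (n := n) (V := good_words n l).
- by rewrite ltnW.
- by apply: fintype.subset_trans (finset.subsetDl _ _) (cyclic_words_sub _ _).
rewrite lee_fin /cylinder_mass -/M.
rewrite (card_reduced_words hmu) -/M in hc; last by lia.
rewrite ler_pdivlMr ?ltr0n ?muln_gt0 ?expn_gt0 ?M0 //.
rewrite mulrC ler_pdivrMr ?ltr0n ?muln_gt0 // -natrM ler_nat.
have -> : n.-1 = (n.-1).-1.+1 by lia.
rewrite expnSr [leqLHS]mulnA [leqRHS]mulnCA [leqRHS]mulnA.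
exact: leq_mul.
Qed.

Lemma frequently_good_words p (Q : set (borel_boundary k)) : (0 < p)%N ->
  {ae mu, forall w, Q w} -> exists2 w, Q w & forall N, exists2 j, (N <= j)%N &
    prefix_tuple w (p.+1 * j) \in good_words (p.+1 * j) (p * j).
Proof.
move=> p0 aeQ; have [c c0 hc] := good_words_mass p0.
(* The shift by one keeps every prefix length positive, so that each [F j] is measurable. *)
pose F j := prefix_in (good_words (p.+1 * j.+1) (p * j.+1)).
have hF : (\forall j \near \oo, (c%:E <= mu (F j))%E)%classic.
  by case: hc => J _ hJ; exists J => // j /= Jj; apply: hJ => /=; rewrite leqW.
have [|w Qw Sw] := lim_sup_set_ae _ c0 hF aeQ.
  move=> j; apply: (prefix_in_mass hmu _ _).1 => //.
  by apply: fintype.subset_trans (finset.subsetDl _ _) (cyclic_words_sub _ _).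
exists w => // N; have [j /= Nj Fj] := Sw N I.
by exists j.+1 => //; rewrite leqW.
Qed.

End GoodWords.

Local Open Scope ring_scope.

(** * Lipschitz bounds and geometric growth of cyclic lengths *)

Lemma morph_lipschitz k (f : free_group k -> free_group k) :
  {morph f : u v / (u * v)%g} ->
  exists2 C, (0 < C)%N & forall w, (len (f w) <= C * len w)%N.
Proof.
move=> fM; pose C := (\max_(x : letter k) len (f (gen x))).+1.
have f1 : f 1%g = 1%g.
  by apply: (@mulgI _ (f 1%g)); rewrite -fM !mulg1.
exists C => // w; have [n] := ubnP (len w); elim: n w => // n IH w hn.
case ew : (word w) => [|x s].
  by rewrite (_ : w = 1%g) ?f1 //; apply: val_inj.
have hs : reduced s by have := wordP w; rewrite ew => /reduced_behead.
have -> : w = (gen x * FreeGroup hs)%g.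
  by apply: val_inj; rewrite -[RHS]/(word _) mul_cat ?ew //; have := wordP w; rewrite ew.
rewrite fM; apply: leq_trans (len_mul _ _) _.
rewrite [in leqRHS]/len mul_cat /=; last by have := wordP w; rewrite ew.
rewrite mulnS leq_add //; first by rewrite leqW // (leq_bigmax x).
by apply: IH; move: hn; rewrite /len ew.
Qed.

Lemma iter_lipschitz k (f : free_group k -> free_group k) C n w :
  (forall w, (len (f w) <= C * len w)%N) -> (len (iter n f w) <= C ^ n * len w)%N.
Proof.
move=> fC; elim: n => [|n IH] /=; first by rewrite mul1n.
by apply: leq_trans (fC _) _; rewrite expnS -mulnA leq_mul2l IH orbT.
Qed.

Lemma iter_cancel T (f g : T -> T) n : cancel f g -> cancel (iter n f) (iter n g).
Proof. by move=> fK; elim: n => // n IH x; rewrite iterSr /= fK IH. Qed.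

(** Growth by the factor [s] starts only at the first iterate, which costs one [s]; comparing the
    start with it by [h0] costs the other. *)
Lemma cyc_len_growth (k : nat) (R : realType)
    (phi phi_inv : free_group k -> free_group k) (s : R) (m : nat) w N :
  cancel phi phi_inv -> hyperbolic_with phi phi_inv s m ->
  (cyc_len w)%:R < s * (cyc_len (iter m phi w))%:R ->
  s ^+ N * (cyc_len w)%:R <= s ^+ 2 * (cyc_len (iter (N * m) phi w))%:R.
Proof.
move=> phiK [s1 _ hyp] h0; pose a i : R := (cyc_len (iter (i * m) phi w))%:R.
have a_ge0 i : 0 <= a i by rewrite ler0n.
have step i : a i < s * a i.+1 -> s * a i.+1 <= a i.+2.
  move=> hi; have := hyp (iter (i.+1 * m) phi w).
  have -> : iter m phi (iter (i.+1 * m) phi w) = iter (i.+2 * m) phi w.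
    by rewrite -iterD -mulSn.
  have -> : iter m phi_inv (iter (i.+1 * m) phi w) = iter (i * m) phi w.
    by rewrite mulSn iterD (iter_cancel _ phiK).
  by rewrite le_max => /orP[//|h]; have := lt_le_trans hi h; rewrite ltxx.
have grow i : a i < s * a i.+1.
  elim: i => [|i IH]; first by rewrite /a mul1n.
  (* Strictness in [IH] forces [a i.+1] to be positive, so [a i.+1 < s * a i.+1]. *)
  have h := step _ IH; have := a_ge0 i; have := a_ge0 i.+1; nra.
have geo i : s ^+ i * a 1%N <= a i.+1.
  elim: i => [|i IH]; first by rewrite mul1r.
  by rewrite exprS -mulrA (le_trans _ (step _ (grow i))) // ler_pM2l //; lra.
case: N => [|N].
  by rewrite expr0 mul1r mul0n ler_peMl ?ler0n // exprn_ege1 // ltW.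
have := grow 0%N => g0; rewrite -/(a N.+1) -[cyc_len w]/(cyc_len (iter (0 * m) phi w)) -/(a 0%N).
have sN : 0 < s ^+ N by rewrite exprn_gt0 //; lra.
rewrite exprSr -mulrA expr2 -mulrA.
apply: (@le_trans _ _ (s ^+ N * (s * (s * a 1%N)))).
  by rewrite ler_pM2l // ler_pM2l ?ltW //; lra.
by rewrite mulrCA [s ^+ N * _]mulrCA ler_pM2l ?ler_pM2l ?geo //; lra.
Qed.

(** * Limits of n-th roots *)

Lemma nth_root_cvg1 (R : realType) (c : R) : 0 < c ->
  ((fun n : nat => c `^ (n%:R)^-1) @ \oo --> (1 : R))%classic.
Proof.
move=> c0; rewrite -cvg_shiftS.
have h : ((fun n => expR (harmonic n * ln c)) @ \oo --> (1 : R))%classic.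
  rewrite -(expR0 R) -[X in expR X](mul0r (ln c)).
  apply: continuous_cvg; first exact: continuous_expR.
  by apply: cvgMl; apply: cvg_harmonic.
apply: cvg_trans h; apply: near_eq_cvg; apply: nearW => n.
by rewrite /= /powR gt_eqF.
Qed.

Lemma limn_einf_nth_root (R : realType) (u : nat -> R) (c s : R) m :
  0 < c -> 1 < s -> (0 < m)%N -> (forall n, c * s ^+ (n %/ m) <= u n) ->
  ((s `^ (m%:R)^-1)%:E <= limn_einf (fun n => (u n `^ (n%:R)^-1)%:E))%E.
Proof.
move=> c0 s1 m0 hu; have s0 : 0 < s by lra.
(* Rounding [n / m] down loses at most one factor [s], whence [c / s], whose n-th root tends to
   1. *)
pose v n := (c / s) `^ (n%:R)^-1 * s `^ (m%:R)^-1.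
have vu n : (0 < n)%N -> v n <= u n `^ (n%:R)^-1.
  move=> n0; have nR : (n%:R : R) != 0 by rewrite pnatr_eq0 -lt0n.
  have -> : v n = (c / s * s `^ (n%:R / m%:R)) `^ (n%:R)^-1.
    rewrite powRM ?powR_ge0 ?divr_ge0 ?ltW // -powRrM.
    by rewrite mulrAC mulfV // mul1r.
  have h : c / s * s `^ (n%:R / m%:R) <= c * s ^+ (n %/ m).
    rewrite -mulrA ler_pM2l // mulrC ler_pdivrMr // -exprSr -powR_mulrn ?(ltW s0) //.
    apply: ler_powR; first exact: ltW.
    rewrite ler_pdivrMr ?ltr0n // -natrM ler_nat.
    by rewrite mulSn addnC {1}(divn_eq n m) leq_add2l ltnW ?ltn_pmod.
  have h0 : 0 <= c / s * s `^ (n%:R / m%:R) by rewrite mulr_ge0 ?powR_ge0 ?divr_ge0 ?ltW.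
  apply: ge0_ler_powR; rewrite ?invr_ge0 ?ler0n ?nnegrE //.
    by rewrite (le_trans _ (hu n)) // (le_trans h0).
  exact: le_trans h (hu n).
have cv : ((fun n => (v n)%:E) @ \oo --> (s `^ (m%:R)^-1)%:E)%classic.
  apply: cvg_EFin; first exact: nearW.
  rewrite -[X in (_ --> X)%classic]mul1r; apply: cvgMl.
  by apply: nth_root_cvg1; rewrite divr_gt0.
rewrite -(cvg_limn_einf_sup cv).1 !limn_einf_lim.
apply: lee_lim; [exact: is_cvg_einfs|exact: is_cvg_einfs|].
exists 1%N => // n /= n0; apply: le_ereal_inf_tmp => _ [i /= ni <-].
apply: (@le_trans _ _ (v i)%:E); first by apply: ereal_inf_lbound; exists i.
by rewrite lee_fin vu // (leq_trans n0).
Qed.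

(** * Lower bound for the stretching factors *)

Lemma morph_conj (G H : groupType) (f : G -> H) :
  {morph f : u v / (u * v)%g} -> {morph f : u g / (u ^ g)%g}.
Proof. by move=> fM u g; apply: (mulgI (f g)); rewrite -fM -!conjgC fM. Qed.

Lemma stretching_factor_ge (R : realType) (k : nat) (k0 : (0 < k)%N)
    (mu : probability (borel_boundary k) R)
    (phi : {multiplicative free_group k.+1 -> free_group k.+1})
    (phi_inv : free_group k.+1 -> free_group k.+1) (s : R) (m : nat) :
  is_uniform_measure mu -> cancel phi phi_inv -> cancel phi_inv phi ->
  hyperbolic_with phi phi_inv s m ->
  exists2 c : R, 0 < c & forall n l,
    is_generic_stretching_factor mu (iter n phi) l -> c * s ^+ (n %/ m) <= l.
Proof.
move=> hmu phiK phi_invK hphi; have [s1 m0 _] := hphi.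
have s0 : 0 < s by lra.
have [C C0 hC] := morph_lipschitz (can2_gmulfM phiK phi_invK).
have CR : 0 < C%:R :> R by rewrite ltr0n.
have D0 : 0 < s ^+ 2 * C%:R ^+ m by rewrite mulr_gt0 // exprn_gt0.
(* Independent of [n]: [s ^+ 2] is the loss in [cyc_len_growth], and [C ^ m] bounds the cost of
   undoing fewer than [m] iterations of [phi]. *)
exists ((s ^+ 2 * C%:R ^+ m)^-1); first by rewrite invr_gt0.
move=> n l hl; set psi := iter m phi.
have psiJ : {morph psi : u g / (u ^ g)%g}.
  rewrite /psi; elim: m {psi hphi m0 D0} => // i IH u g.
  by rewrite !iterS IH (morph_conj (@gmulfM _ _ phi)).
have psi_bij : bijective psi by exists (iter m phi_inv); apply: iter_cancel.
(* With p + 1 <= s p, ||psi v|| > p j and ||v|| = (p + 1) j give ||v|| < s ||psi v||. *)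
pose p := (Num.bound ((s - 1)^-1)).
have ps : p.+1%:R <= s * p%:R.
  have s10 : 0 < s - 1 by lra.
  have : (s - 1)^-1 < p%:R by apply: archi_boundP; rewrite invr_ge0 ltW.
  by rewrite -[_^-1]mul1r ltr_pdivrMr // -natr1; lra.
have p0 : (0 < p)%N by rewrite lt0n; apply/eqP => pE; rewrite pE mulr0 in ps; lra.
have [w wl wgood] := frequently_good_words hmu k0 psiJ psi_bij p0 hl.
(* If [l] were below the bound, so would be all late quotients, but good prefixes of arbitrarily
   large length [q] reach it. *)
rewrite leNgt; apply/negP => lb.
have [J _ hJ] := cvgr_lt _ wl _ lb.
have [j jJ] := wgood (J + 1)%N.
have j0 : (0 < j)%N by apply: leq_trans jJ; rewrite addn1.
set q := (p.+1 * j)%N; have q0 : (0 < q)%N by rewrite muln_gt0.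
have qJ : (J <= q)%N by rewrite /q; nia.
rewrite finset.inE => /andP[ncon cyc].
have {ncon} long : (p * j < cyc_len (psi (initial_segment w q)))%N.
  by move: ncon; rewrite finset.inE cyc /= -ltnNge of_word_prefix.
have {}cyc : cyclically_reduced (initial_segment w q).
  by move: cyc; rewrite finset.inE.
have lenq : cyc_len (initial_segment w q) = q.
  by rewrite cyc_len_reduced // /len size_mkseq.
have := hJ q qJ; apply/negP; rewrite -leNgt.
set v := initial_segment w q in long cyc lenq *.
have first : (cyc_len v)%:R < s * (cyc_len (psi v))%:R.
  rewrite lenq /q natrM; apply: (@le_lt_trans _ _ (s * (p * j)%N%:R)).
    by rewrite natrM mulrA ler_pM2r // ltr0n.
  by rewrite ltr_pM2l // ltr_nat.
have := cyc_len_growth (n %/ m) phiK hphi first; rewrite lenq => grow.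
have lip : (cyc_len (iter (n %/ m * m) phi v) <= C ^ m * len (iter n phi v))%N.
  apply: leq_trans (cyc_len_le _) _.
  (* The largest multiple of [m] up to [n] is reached from [n] by [n %% m] steps of [phi_inv]. *)
  rewrite -[X in len X](iter_cancel (n %% m) phiK) -iterD addnC -divn_eq.
  apply: leq_trans (iter_lipschitz _ _ hC) _.
  by rewrite leq_mul2r leq_pexp2l ?orbT // ltnW ?ltn_pmod.
rewrite ler_pdivlMr ?ltr0n // -mulrA ler_pdivrMl // (le_trans grow) //.
by rewrite -(mulrA (s ^+ 2)) ler_pM2l ?exprn_gt0 // -natrX -natrM ler_nat.
Qed.

Theorem theorem5 (R : realType) (k : nat) (hk : (2 <= k.+1)%N)
  (mu : probability (borel_boundary k) R) (hmu : is_uniform_measure mu)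
  (phi : {multiplicative free_group k.+1 -> free_group k.+1})
  (phi_inv : free_group k.+1 -> free_group k.+1)
  (phiK : cancel phi phi_inv) (phi_invK : cancel phi_inv phi)
  (lambda : (free_group k.+1 -> free_group k.+1) -> R)
  (hlambda : forall n : nat,
     is_generic_stretching_factor mu (iter n phi) (lambda (iter n phi)))
  (s : R) (m : nat) (hphi : hyperbolic_with phi phi_inv s m) :
  ((s `^ (m%:R)^-1)%:E <=
     limn_einf (fun n : nat => (lambda (iter n phi) `^ (n%:R)^-1)%:E))%E
  /\ 1 < s `^ (m%:R)^-1.
Proof.
have [s1 m0 _] := hphi; split.
  have [c c0 hc] := stretching_factor_ge hk hmu phiK phi_invK hphi.
  by apply: (limn_einf_nth_root c0 s1 m0) => n; apply: hc.
apply: (@le_lt_trans _ _ (1 `^ (m%:R)^-1)); first by rewrite powR1.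
by apply: gt0_ltr_powR; rewrite ?invr_gt0 ?ltr0n ?nnegrE //; lra.
Qed.
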